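(* Let $J\in\{1,2,\dots\}$ and let $g^1,\dots,g^J,\gamma^1,\dots,\gamma^J\in\mathbb{C}^N$. If $$\sum_{j=1}^J\operatorname{Re}\big(\overline{\hat g^j(\ell)}\,\hat\gamma^j(\ell)\big)\ge 0\quad\forall\,\ell=1,\dots,N-1,\qquad\text{and}\qquad\sum_{j=1}^J\operatorname{Re}\big(\overline{\hat g^j(0)}\,\hat\gamma^j(0)\big)>0,$$ then $$\sum_{j=1}^J\langle T_i\gamma^j,T_ig^j\rangle\neq 0,\qquad\forall i=1,\dots,N.$$
   Context: Let $G=(V,E)$ be a finite, connected, undirected, weighted simple graph with vertex set $V=\{1,\dots,N\}$, and let $W=(W_{ij})$ be its weighted adjacency matrix: real, symmetric, zero diagonal, $W_{ij}\ge 0$, with $W_{ij}\neq0$ exactly when $i,j$ are adjacent. Let $D=\operatorname{diag}(d_1,\dots,d_N)$ with $d_i=\sum_{j}W_{ij}$, and let $\mathcal{L}=D-W$ be the graph Laplacian. Fix an orthonormal basis $(\chi_0,\dots,\chi_{N-1})$ of $\mathbb{C}^N$ consisting of eigenvectors of $\mathcal{L}$, ordered so that the eigenvalues satisfy $0=\lambda_0<\lambda_1\le\dots\le\lambda_{N-1}$ (so $|\chi_0(i)|=1/\sqrt N$ for all $i$). Signals are vectors $f=(f(1),\dots,f(N))\in\mathbb{C}^N$; the inner product $\langle f,h\rangle=\sum_{i=1}^N f(i)\overline{h(i)}$ is conjugate-linear in the second argument. Graph Fourier transform: $\hat f(\ell)=\langle f,\chi_\ell\rangle$, $\ell=0,\dots,N-1$;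 $\hat g^j$ denotes the graph Fourier transform of $g^j$ and $\hat\gamma^j$ that of $\gamma^j$ (the superscript $j$ is an index, not a power). Generalized translation, for $n\in\{1,\dots,N\}$: $(T_nf)(i)=\sqrt N\sum_{\ell=0}^{N-1}\hat f(\ell)\overline{\chi_\ell(n)}\chi_\ell(i)$. *)

(* Defs.v *)
From mathcomp Require Import all_boot all_order all_algebra.
From mathcomp Require Import spectral complex reals.

Set Implicit Arguments.
Unset Strict Implicit.
Unset Printing Implicit Defensive.

Import Order.TTheory GRing.Theory Num.Theory.
Local Open Scope ring_scope.
Local Open Scope complex_scope.

(* N = m.+1: a connected graph has a vertex, and the index 0 must exist.      *)
(* The vertices 1, ..., N and the frequencies 0, ..., N-1 are both 'I_m.+1.   *)

Record connected_simple_graph (m : nat) (e : rel 'I_m.+1) : Prop := {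
  graph_sym : symmetric e;
  graph_irrefl : irreflexive e;
  graph_connected : forall i j, connect e i j
}.

Record weighted_adjacency (R : realType) (m : nat) (e : rel 'I_m.+1)
    (W : 'M[R]_m.+1) : Prop := {
  weight_sym : W^T = W;
  weight_diag : forall i, W i i = 0;
  weight_ge0 : forall i j, 0 <= W i j;
  weight_edge : forall i j, (W i j != 0) = e i j
}.

Definition laplacian (R : realType) (m : nat) (W : 'M[R]_m.+1) : 'M[R]_m.+1 :=
  diag_mx (\row_i \sum_j W i j) - W.

(* Signals are row vectors, because [dotmx] is defined on these.              *)
Lemma dotmx_sumE (R : realType) (m : nat) (f h : 'rV[R[i]]_m.+1) :
  dotmx f h = \sum_i f 0 i * Num.conj (h 0 i).
Proof. by rewrite dotmxE mxE; apply: eq_bigr => i _; rewrite !mxE. Qed.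

Record orthonormal_basis (R : realType) (m : nat)
    (chi : 'I_m.+1 -> 'rV[R[i]]_m.+1) : Prop := {
  onb_basis : basis_of fullv [tuple chi l | l < m.+1];
  onb_dot : forall k l, dotmx (chi k) (chi l) = (k == l)%:R
}.

Record laplacian_eigenbasis (R : realType) (m : nat) (W : 'M[R]_m.+1)
    (lambda : 'I_m.+1 -> R) (chi : 'I_m.+1 -> 'rV[R[i]]_m.+1) : Prop := {
  eigenbasis_onb : orthonormal_basis chi;
  eigenbasis_eigen : forall l,
    map_mx (real_complex R) (laplacian W) *m (chi l)^T
      = (lambda l)%:C *: (chi l)^T;
  eigenbasis_lambda0 : lambda ord0 = 0;
  eigenbasis_lambda_gt0 : forall l, l != ord0 -> 0 < lambda l;
  eigenbasis_lambda_le : forall k l : 'I_m.+1, (k <= l)%N ->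
    lambda k <= lambda l
}.

Definition gft (R : realType) (m : nat) (chi : 'I_m.+1 -> 'rV[R[i]]_m.+1)
    (f : 'rV[R[i]]_m.+1) (l : 'I_m.+1) : R[i] :=
  dotmx f (chi l).

Definition translation (R : realType) (m : nat)
    (chi : 'I_m.+1 -> 'rV[R[i]]_m.+1) (n : 'I_m.+1) (f : 'rV[R[i]]_m.+1) :
    'rV[R[i]]_m.+1 :=
  \row_i (sqrtC m.+1%:R
            * \sum_l gft chi f l * Num.conj (chi l 0 n) * chi l 0 i).

(* Main.v *)
Require Import Defs.
From mathcomp Require Import all_boot all_order all_algebra.
From mathcomp Require Import spectral complex reals.

(** The translates are diagonal in the Fourier basis: the coefficient of
    [T_i f] on [chi l] is that of [f], multiplied by
    [sqrt N * conj (chi l i)].  Parseval's identity therefore gives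
[[
    sum_j <T_i gamma_j, T_i g_j>
      = sum_l N |chi l i|^2 sum_j conj (ghat_j l) * gammahat_j l
]]
    (lemma [dotmx_translation]).  The weights [N |chi l i|^2] are real and
    nonnegative, so the real part of this sum is the same combination of the
    real parts in the hypotheses: every term is nonnegative, and the term
    [l = 0] is positive as soon as [chi 0 i != 0].

    The eigenvector [chi 0] vanishes nowhere (lemma [eigenvector0_neq0])
    because the constant signal 1 lies in the kernel of the Laplacian: it is
    orthogonal to the eigenvectors of nonzero eigenvalue, that is, to all
    [chi l] with [l != 0], and is thus a multiple of [chi 0]. *)

Set Implicit Arguments.
Unset Strict Implicit.
Unset Printing Implicit Defensive.

Import Order.TTheory GRing.Theory Num.Theory.
Local Open Scope ring_scope.
Local Open Scope complex_scope.

Lemma Re_sum (R : realType) (I : Type) (r : seq I) (P : pred I)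
    (F : I -> R[i]) :
  complex.Re (\sum_(k <- r | P k) F k) = \sum_(k <- r | P k) complex.Re (F k).
Proof. by apply: (big_morph (@complex.Re R)) => // -[a b] [c d]. Qed.

Lemma Re_realM (R : realType) (w z : R[i]) :
  w \is Num.real -> complex.Re (w * z) = complex.Re w * complex.Re z.
Proof.
move=> /RRe_real <-; case: w z => a b [c d] /=.
by rewrite mul0r subr0.
Qed.

Lemma orthonormal_unitarymx (R : realType) (m : nat)
    (chi : 'I_m.+1 -> 'rV[R[i]]_m.+1) :
  orthonormal_basis chi -> \matrix_l chi l \is unitarymx.
Proof.
by case=> _ chi_dot; apply/row_unitarymxP => k l; rewrite !rowK chi_dot.
Qed.

(** The dual orthonormality relation: a square matrix with orthonormal rows
    also has orthonormal columns. *)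
Lemma orthonormal_columns (R : realType) (m : nat)
    (chi : 'I_m.+1 -> 'rV[R[i]]_m.+1) (i k : 'I_m.+1) :
  orthonormal_basis chi ->
  \sum_l Num.conj (chi l 0 i) * chi l 0 k = (i == k)%:R.
Proof.
move=> /orthonormal_unitarymx/unitarymxP/mulmx1C/matrixP/(_ i k).
by rewrite !mxE => <-; apply: eq_bigr => l _; rewrite !mxE.
Qed.

Lemma laplacian_colsum (R : realType) (m : nat) (W : 'M[R]_m.+1) (j : 'I_m.+1) :
  W^T = W -> \sum_i laplacian W i j = 0.
Proof.
move=> W_sym; under eq_bigr do rewrite !mxE.
have degE : \sum_i (\sum_k W i k) *+ (i == j) = \sum_k W j k.
  rewrite (bigD1 j) //= eqxx [X in _ + X]big1 ?addr0 // => i /negbTE ->.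
  by rewrite mulr0n.
rewrite sumrB [X in X - _]degE; apply/eqP; rewrite subr_eq0; apply/eqP.
by apply: eq_bigr => i _; rewrite -{1}W_sym mxE.
Qed.

(** Summing the entries of [L chi_l = lambda_l chi_l] kills the left-hand side,
    as the columns of [L] sum to zero, and [lambda_l] is nonzero.  This is the
    orthogonality of [chi l] to the constant signals. *)
Lemma eigenvector_sum0 (R : realType) (m : nat) (W : 'M[R]_m.+1)
    (lambda : 'I_m.+1 -> R) (chi : 'I_m.+1 -> 'rV[R[i]]_m.+1) (l : 'I_m.+1) :
  W^T = W -> laplacian_eigenbasis W lambda chi -> l != ord0 ->
  \sum_k chi l 0 k = 0.
Proof.
move=> W_sym hchi l_neq0.
have lambda_neq0 : (lambda l)%:C != 0.
  by rewrite fmorph_eq0 gt_eqF // (eigenbasis_lambda_gt0 hchi).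
apply: (mulfI lambda_neq0); rewrite mulr0 mulr_sumr.
transitivity (\sum_k \sum_j (laplacian W k j)%:C * chi l 0 j).
  apply: eq_bigr => k _.
  have /matrixP/(_ k 0) := eigenbasis_eigen hchi l.
  by rewrite !mxE => <-; apply: eq_bigr => j _; rewrite !mxE.
rewrite exchange_big big1 // => j _.
by rewrite -mulr_suml -rmorph_sum laplacian_colsum // rmorph0 mul0r.
Qed.

(** At a vertex [i] the Fourier expansion of the constant signal 1 reduces to
    [1 = <1, chi 0> * chi 0 i]. *)
Lemma eigenvector0_neq0 (R : realType) (m : nat) (W : 'M[R]_m.+1)
    (lambda : 'I_m.+1 -> R) (chi : 'I_m.+1 -> 'rV[R[i]]_m.+1) (i : 'I_m.+1) :
  W^T = W -> laplacian_eigenbasis W lambda chi -> chi ord0 0 i != 0.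
Proof.
move=> W_sym hchi; apply/eqP => chi0i.
have /eqP := oner_neq0 R[i]; apply.
transitivity (\sum_k \sum_l Num.conj (chi l 0 k) * chi l 0 i).
  rewrite (bigD1 i) //= (orthonormal_columns _ _ (eigenbasis_onb hchi)) eqxx.
  rewrite big1 ?addr0 // => k /negbTE k_neqi.
  by rewrite (orthonormal_columns _ _ (eigenbasis_onb hchi)) k_neqi.
rewrite exchange_big big1 // => l _; rewrite -mulr_suml -rmorph_sum.
have [->|l_neq0] := eqVneq l ord0; first by rewrite chi0i mulr0.
by rewrite (eigenvector_sum0 W_sym hchi l_neq0) rmorph0 mul0r.
Qed.

Lemma dotmx_unitaryr (R : realType) (m n : nat) (U : 'M[R[i]]_(m, n))
    (u v : 'rV[R[i]]_m) :
  U \is unitarymx -> dotmx (u *m U) (v *m U) = dotmx u v.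
Proof.
by move=> U_unitary; rewrite !dotmxE trmx_mul map_mxM mulmxA mulmxtVK.
Qed.

Lemma translationE (R : realType) (m : nat)
    (chi : 'I_m.+1 -> 'rV[R[i]]_m.+1) (n : 'I_m.+1) (f : 'rV[R[i]]_m.+1) :
  translation chi n f =
    (\row_l (sqrtC m.+1%:R * (gft chi f l * Num.conj (chi l 0 n))))
      *m \matrix_l chi l.
Proof.
apply/rowP=> k; rewrite !mxE mulr_sumr.
by apply: eq_bigr => l _; rewrite !mxE !mulrA.
Qed.

(** By [translationE] the Fourier coefficients of a translate are those of the
    signal times [sqrt N * conj (chi l n)], and the unitary Fourier matrix
    preserves the inner product; the squares of these factors become the
    weights. *)
Lemma dotmx_translation (R : realType) (m : nat)
    (chi : 'I_m.+1 -> 'rV[R[i]]_m.+1) (n : 'I_m.+1) (f h : 'rV[R[i]]_m.+1) :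
  orthonormal_basis chi ->
  dotmx (translation chi n f) (translation chi n h) =
    \sum_l m.+1%:R * `|chi l 0 n| ^+ 2
             * (Num.conj (gft chi h l) * gft chi f l).
Proof.
move=> /orthonormal_unitarymx U_unitary.
rewrite !translationE dotmx_unitaryr // dotmx_sumE.
apply: eq_bigr => l _; rewrite !mxE !rmorphM /= conjCK.
have sqrtN_real : Num.conj (sqrtC m.+1%:R) = sqrtC m.+1%:R :> R[i].
  by apply: geC0_conj; rewrite sqrtC_ge0 ler0n.
rewrite sqrtN_real -[m.+1%:R in RHS]sqrtCK normCK !expr2.
rewrite mulrACA -[RHS]mulrA; congr (_ * _).
by rewrite mulrACA [LHS]mulrC; congr (_ * _); rewrite mulrC.
Qed.

Theorem lemma4p2 (R : realType) (m : nat)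
    (e : rel 'I_m.+1) (W : 'M[R]_m.+1)
    (lambda : 'I_m.+1 -> R) (chi : 'I_m.+1 -> 'rV[R[i]]_m.+1)
    (J : nat) (g gamma : 'I_J -> 'rV[R[i]]_m.+1)
    (hG : connected_simple_graph e)
    (hW : weighted_adjacency e W)
    (hchi : laplacian_eigenbasis W lambda chi)
    (hJ : (0 < J)%N)
    (hnonneg : forall l : 'I_m.+1, l != ord0 ->
       0 <= \sum_(j < J) complex.Re
              (Num.conj (gft chi (g j) l) * gft chi (gamma j) l))
    (hpos :
       0 < \sum_(j < J) complex.Re
             (Num.conj (gft chi (g j) ord0) * gft chi (gamma j) ord0)) :
  forall i : 'I_m.+1,
    \sum_(j < J) dotmx (translation chi i (gamma j)) (translation chi i (g j))
      <> 0.
Proof.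
move=> i sum_eq0.
have onb := eigenbasis_onb hchi.
pose w l : R[i] := m.+1%:R * `|chi l 0 i| ^+ 2.
pose s l := \sum_(j < J)
  complex.Re (Num.conj (gft chi (g j) l) * gft chi (gamma j) l).
have w_ge0 l : 0 <= w l by rewrite mulr_ge0 ?ler0n ?exprn_ge0.
have Re_w_ge0 l : 0 <= complex.Re (w l).
  by have := w_ge0 l; rewrite lecE => /andP[].
have Re_w0_gt0 : 0 < complex.Re (w ord0).
  have : 0 < w ord0.
    by rewrite mulr_gt0 ?ltr0n ?exprn_gt0 ?normr_gt0
               ?(eigenvector0_neq0 i (weight_sym hW) hchi).
  by rewrite ltcE => /andP[].
(* The real part of the sum that is supposed to vanish. *)
have Re_sumE : \sum_l complex.Re (w l) * s l = 0.
  rewrite -[RHS]/(complex.Re (0 : R[i])) -sum_eq0 Re_sum.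
  under [RHS]eq_bigr do rewrite dotmx_translation // Re_sum.
  rewrite [RHS]exchange_big; apply: eq_bigr => l _.
  rewrite mulr_sumr; apply: eq_bigr => j _.
  by rewrite -Re_realM ?ger0_real.
have : 0 < \sum_l complex.Re (w l) * s l.
  rewrite (bigD1 ord0) //= ltr_pwDl ?mulr_gt0 //.
  by apply: sumr_ge0 => l l_neq0; rewrite mulr_ge0 ?hnonneg.
by rewrite Re_sumE ltxx.
Qed.
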